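(* Let $M,N,K$ be positive integers and let $X^\star=A_{rf}D_{\tilde c}\Phi^\top\in\mathbb{C}^{M\times N}$ be a data matrix with true damping-frequency pairs $\mathcal{RF}=\{(r_1,f_1),\dots,(r_K,f_K)\}$, $r_k\in[0,1]$, $f_k\in[0,1)$, as described in the context, with all pairs $(r_k,f_k)$ distinct. Let $\Omega\subset\{1,\dots,M\}\times\{1,\dots,N\}$ be a uniformly randomly sampled set of observed locations, so that $X^\star_\Omega$ is given. Let $\widehat X$ be any solution of $$\min_{X\in\mathbb{C}^{M\times N}}\|X\|_*\quad\text{s.t. } X_\Omega=X^\star_\Omega,$$ with truncated SVD $\widehat X=U_{\widehat X}S_{\widehat X}V_{\widehat X}^H$, and let $Q$ be a solution of the dual problem $$\max_{Q\in\mathbb{C}^{M\times N}}\ \mathrm{Re}\,\mathrm{Tr}\big(Q_\Omega^HX^\star_\Omega\big)\quad\text{s.t. }\|Q_\Omega\|\le 1 .$$ Then $Q_\Omega=U_{\widehat X}V_{\widehat X}^H+W$ for some matrix $W$ with $U_{\widehat X}^HW=0$, $WV_{\widehat X}=0$ and $\|W\|\le1$. Consider dual solutions with $Q=Q_\Omega$. If the range space of $\widehat X$ contains the range space of $X^\star$, i.e. $\mathcal{R}(\widehat X)\supseteq\mathcal{R}(X^\star)$, and $\|W\|<1$, then the dual polynomial $\mathcal{Q}(r,f)=Q^Ha(r,f)$, $(r,f)\in[0,1]\times[0,1)$, satisfies: (i) $\|\mathcal{Q}(r,f)\|_2=1$ for all $(r,f)\in\mathcal{RF}$, and for all $(r,f)\notin\mathcal{RF}$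 with $a(r,f)\in\mathcal{R}(U_{\widehat X})$; (ii) $\|\mathcal{Q}(r,f)\|_2<1$ for all $(r,f)\notin\mathcal{RF}$ with $a(r,f)\notin\mathcal{R}(U_{\widehat X})$.
   Context: For $r\in[0,1]$ and $f\in[0,1)$ define the unit-norm vector $a(r,f)\in\mathbb{C}^M$ by $a(r,f)=\sqrt{\tfrac{1-r^2}{1-r^{2M}}}\,[1,\ re^{j2\pi f},\ \dots,\ r^{M-1}e^{j2\pi f(M-1)}]^\top$ if $r<1$, and $a(1,f)=\tfrac{1}{\sqrt M}[1,\ e^{j2\pi f},\ \dots,\ e^{j2\pi f(M-1)}]^\top$ (with $j=\sqrt{-1}$). Data matrix: let $c_1,\dots,c_K\in\mathbb{C}\setminus\{0\}$ and let $\phi_1,\dots,\phi_K\in\mathbb{C}^N$ with $\|\phi_k\|_2=1$. Put $\tilde c_k=c_k\sqrt{\tfrac{1-r_k^{2M}}{1-r_k^2}}$ if $r_k<1$ and $\tilde c_k=c_k\sqrt M$ if $r_k=1$; $A_{rf}=[a(r_1,f_1),\dots,a(r_K,f_K)]\in\mathbb{C}^{M\times K}$, $D_{\tilde c}=\mathrm{diag}(\tilde c_1,\dots,\tilde c_K)$, $\Phi=[\phi_1,\dots,\phi_K]\in\mathbb{C}^{N\times K}$. The data matrix is $X^\star=A_{rf}D_{\tilde c}\Phi^\top$. For a matrix $X$, $X_\Omega$ denotes the matrix that agrees with $X$ at entries $(i,j)\in\Omega$ and is $0$ elsewhere. $\mathcal{R}(\cdot)$ is the range (column space), $\top$ transpose,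 $H$ conjugate transpose, $\|\cdot\|_*$ the nuclear norm, $\|\cdot\|$ the spectral norm. A truncated SVD keeps only the nonzero singular values.
   Formalization: The claim in (i) for the true pairs in RF is proved under the added hypothesis that the range of X* equals the range of A_rf (as when Φ has full column rank); without it that claim is false, e.g. for M=2, N=1, K=2 with all entries observed. *)

(* Defs.v *)
From HB Require Import structures.
From mathcomp Require Import all_boot all_order all_algebra.
From mathcomp Require Import complex.
From mathcomp Require Import all_classical all_reals all_analysis.

Set Implicit Arguments.
Unset Strict Implicit.
Unset Printing Implicit Defensive.

Import Order.TTheory GRing.Theory Num.Theory.
Local Open Scope classical_set_scope.
Local Open Scope sesquilinear_scope.
Local Open Scope complex_scope.
Local Open Scope ring_scope.

Definition l2norm (R : realType) (n : nat) (v : 'cV[R[i]]_n) : R :=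
  Num.sqrt (\sum_(i < n) Normc.normc (v i ord0) ^+ 2).

(* The N singular values of an M x N matrix, zeros included: the square roots *)
(* of the eigenvalues of X^H X, which are real and nonnegative, so that Re    *)
(* only changes the type.                                                     *)
Definition singval (R : realType) (M N : nat) (X : 'M[R[i]]_(M, N))
    (i : 'I_N) : R :=
  Num.sqrt (complex.Re (spectral_diag (X ^t* *m X) ord0 i)).

Definition nuclear_norm (R : realType) (M N : nat) (X : 'M[R[i]]_(M, N)) : R :=
  \sum_(i < N) singval X i.

Definition spectral_norm (R : realType) (M N : nat) (X : 'M[R[i]]_(M, N)) : R :=
  \big[Num.max/0]_(i < N) singval X i.

(* The order of the singular values is left free.                             *)
Definition truncated_svd (R : realType) (M N p : nat) (X : 'M[R[i]]_(M, N))
    (U : 'M[R[i]]_(M, p)) (s : 'rV[R]_p) (V : 'M[R[i]]_(N, p)) : Prop :=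
  [/\ U ^t* *m U = 1%:M, V ^t* *m V = 1%:M, forall i, 0 < s ord0 i
    & X = U *m diag_mx (map_mx (real_complex R) s) *m V ^t*].

Definition colspace (R : realType) (M N : nat) (X : 'M[R[i]]_(M, N)) :
    set 'cV[R[i]]_M :=
  range (fun v : 'cV[R[i]]_N => X *m v).

Definition restrict_to (R : realType) (M N : nat) (Omega : {set 'I_M * 'I_N})
    (X : 'M[R[i]]_(M, N)) : 'M[R[i]]_(M, N) :=
  \matrix_(i, j) if (i, j) \in Omega then X i j else 0.

Definition expi (R : realType) (t : R) : R[i] := cos t +i* sin t.

(* The case split is meant for r <= 1, so that the second branch is r = 1.    *)
Definition avec_scale (R : realType) (M : nat) (r : R) : R :=
  if r < 1 then Num.sqrt ((1 - r ^+ 2) / (1 - r ^+ (2 * M)))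
  else (Num.sqrt M%:R)^-1.

Definition avec (R : realType) (M : nat) (r f : R) : 'cV[R[i]]_M :=
  \col_(m < M) ((avec_scale M r * r ^+ m)%:C * expi (2 * pi * f * m%:R)).

Definition ctilde (R : realType) (M : nat) (c : R[i]) (r : R) : R[i] :=
  c * (if r < 1 then Num.sqrt ((1 - r ^+ (2 * M)) / (1 - r ^+ 2))
       else Num.sqrt M%:R)%:C.

Definition A_rf (R : realType) (M K : nat) (r f : 'I_K -> R) :
    'M[R[i]]_(M, K) :=
  \matrix_(m, k) avec M (r k) (f k) m ord0.

Definition D_ctilde (R : realType) (M K : nat) (r : 'I_K -> R)
    (c : 'I_K -> R[i]) : 'M[R[i]]_K :=
  diag_mx (\row_k ctilde M (c k) (r k)).

Definition Phi_mx (R : realType) (N K : nat) (phi : 'I_K -> 'cV[R[i]]_N) :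
    'M[R[i]]_(N, K) :=
  \matrix_(n, k) phi k n ord0.

Definition data_matrix (R : realType) (M N K : nat) (r f : 'I_K -> R)
    (c : 'I_K -> R[i]) (phi : 'I_K -> 'cV[R[i]]_N) : 'M[R[i]]_(M, N) :=
  A_rf M r f *m D_ctilde M r c *m (Phi_mx phi)^T.

Definition RF_pairs (R : realType) (K : nat) (r f : 'I_K -> R) : set (R * R) :=
  range (fun k => (r k, f k)).

Definition primal_solution (R : realType) (M N : nat)
    (Omega : {set 'I_M * 'I_N}) (Xs X : 'M[R[i]]_(M, N)) : Prop :=
  restrict_to Omega X = restrict_to Omega Xs /\
  forall Y : 'M[R[i]]_(M, N), restrict_to Omega Y = restrict_to Omega Xs ->
    nuclear_norm X <= nuclear_norm Y.

Definition dual_objective (R : realType) (M N : nat)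
    (Omega : {set 'I_M * 'I_N}) (Xs Q : 'M[R[i]]_(M, N)) : R :=
  complex.Re (\tr ((restrict_to Omega Q) ^t* *m restrict_to Omega Xs)).

Definition dual_solution (R : realType) (M N : nat)
    (Omega : {set 'I_M * 'I_N}) (Xs Q : 'M[R[i]]_(M, N)) : Prop :=
  spectral_norm (restrict_to Omega Q) <= 1 /\
  forall P : 'M[R[i]]_(M, N), spectral_norm (restrict_to Omega P) <= 1 ->
    dual_objective Omega Xs P <= dual_objective Omega Xs Q.

Definition dual_decomposition (R : realType) (M N p : nat)
    (Omega : {set 'I_M * 'I_N}) (Q : 'M[R[i]]_(M, N))
    (U : 'M[R[i]]_(M, p)) (V : 'M[R[i]]_(N, p)) (W : 'M[R[i]]_(M, N)) : Prop :=
  [/\ restrict_to Omega Q = U *m V ^t* + W,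
      U ^t* *m W = 0, W *m V = 0 & spectral_norm W <= 1].

Definition dual_poly (R : realType) (M N : nat) (Q : 'M[R[i]]_(M, N))
    (r f : R) : 'cV[R[i]]_N :=
  Q ^t* *m avec M r f.

(* Main.v *)
Require Import Defs.
From HB Require Import structures.
From mathcomp Require Import all_boot all_order all_algebra.
From mathcomp Require Import complex ring lra.
From mathcomp Require Import all_classical all_reals all_analysis.

(** With respect to the real inner product [Re tr (A^* B)], the nuclear norm is
    the support function of the set of contractions.  Minimality of [Xhat] says
    that the linear functional on the span of [Xhat] and the matrices vanishing
    on [Omega] that takes the value [nuclear_norm Xhat] at [Xhat] and [0] on
    those matrices is dominated by the nuclear norm; by Hahn-Banach it extends
    to [X |-> Re tr (P^* X)] with [P] a contraction supported on [Omega], so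
    there is no duality gap.  Hence the contraction [Q_Omega] attains the
    nuclear norm at [Xhat = U S V^*], which forces [Q_Omega V = U] and
    [Q_Omega^* U = V], and [W = Q_Omega - U V^*] has the required properties.
    Finally [|Q^* a|^2 = |U^* a|^2 + |W^* b|^2] with [b = a - U U^* a], while
    [|a|^2 = |U^* a|^2 + |b|^2 = 1]: the two agree when [b = 0], and [|W| < 1]
    makes the former strictly smaller otherwise. *)

Set Implicit Arguments.
Unset Strict Implicit.
Unset Printing Implicit Defensive.

Import Order.TTheory GRing.Theory Num.Theory.
Local Open Scope classical_set_scope.
Local Open Scope sesquilinear_scope.
Local Open Scope complex_scope.
Local Open Scope ring_scope.

(** * The real inner product on complex matrices *)

Definition rdot (R : realType) (m n : nat) (A B : 'M[R[i]]_(m, n)) : R :=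
  complex.Re (\tr (A ^t* *m B)).

Section RealInnerProduct.
Variable R : realType.
Local Notation C := R[i].

Lemma conjC_conjc (x : C) : x^* = conjc x.
Proof. by []. Qed.

Lemma trmxCM m n p (A : 'M[C]_(m, n)) (B : 'M[C]_(n, p)) :
  (A *m B) ^t* = B ^t* *m A ^t*.
Proof. by rewrite trmx_mul map_mxM. Qed.

Lemma rdotE m n (A B : 'M[C]_(m, n)) :
  rdot A B = \sum_i \sum_j (complex.Re (A i j) * complex.Re (B i j)
                            + complex.Im (A i j) * complex.Im (B i j)).
Proof.
rewrite /rdot /mxtrace exchange_big raddf_sum; apply: eq_bigr => j _ /=.
rewrite mxE raddf_sum; apply: eq_bigr => i _ /=.
rewrite !mxE conjC_conjc.
by case: (A i j) (B i j) => [a b] [c d] /=; rewrite mulNr opprK.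
Qed.

Lemma rdotC m n (A B : 'M[C]_(m, n)) : rdot A B = rdot B A.
Proof.
rewrite !rdotE; apply: eq_bigr => i _; apply: eq_bigr => j _.
by rewrite mulrC [X in _ + X]mulrC.
Qed.

Lemma rdotDr m n (A B D : 'M[C]_(m, n)) : rdot A (B + D) = rdot A B + rdot A D.
Proof. by rewrite /rdot mulmxDr raddfD /= raddfD. Qed.

Lemma rdotNr m n (A B : 'M[C]_(m, n)) : rdot A (- B) = - rdot A B.
Proof. by rewrite /rdot mulmxN raddfN /= raddfN. Qed.

Lemma rdotZr m n (a : R) (A B : 'M[C]_(m, n)) :
  rdot A (a%:C *: B) = a * rdot A B.
Proof.
rewrite /rdot -scalemxAr linearZ /=.
by case: (\tr _) => x y /=; rewrite mul0r subr0.
Qed.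

Lemma rdotDl m n (A B D : 'M[C]_(m, n)) : rdot (A + B) D = rdot A D + rdot B D.
Proof. by rewrite rdotC rdotDr !(rdotC D). Qed.

Lemma rdotNl m n (A B : 'M[C]_(m, n)) : rdot (- A) B = - rdot A B.
Proof. by rewrite rdotC rdotNr rdotC. Qed.

Lemma rdotZl m n (a : R) (A B : 'M[C]_(m, n)) :
  rdot (a%:C *: A) B = a * rdot A B.
Proof. by rewrite rdotC rdotZr rdotC. Qed.

Lemma rdot0l m n (A : 'M[C]_(m, n)) : rdot 0 A = 0.
Proof. by rewrite -[0](subrr A) rdotDl rdotNl subrr. Qed.

Lemma rdot_ge0 m n (A : 'M[C]_(m, n)) : 0 <= rdot A A.
Proof.
by rewrite rdotE !sumr_ge0 // => i _; rewrite sumr_ge0 // => j _; nra.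
Qed.

Lemma rdot_eq0 m n (A : 'M[C]_(m, n)) : (rdot A A == 0) = (A == 0).
Proof.
apply/eqP/eqP => [|->]; last exact: rdot0l.
have sq_ge0 i j : 0 <= complex.Re (A i j) * complex.Re (A i j)
                       + complex.Im (A i j) * complex.Im (A i j) by nra.
rewrite rdotE => /eqP; rewrite psumr_eq0; last by move=> i _; rewrite sumr_ge0.
move=> /allP A0; apply/matrixP => i j; rewrite mxE.
have /eqP/eqP := A0 i (mem_index_enum _); rewrite psumr_eq0//.
move=> /allP /(_ j (mem_index_enum _)) /=.
rewrite paddr_eq0 -?expr2 ?sqr_ge0// !sqrf_eq0.
by case: (A i j) => x y /= /andP[/eqP-> /eqP->].
Qed.

Lemma rdot_le0 m n (A : 'M[C]_(m, n)) : rdot A A <= 0 -> A = 0.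
Proof. by move=> A0; apply/eqP; rewrite -rdot_eq0 eq_le A0 rdot_ge0. Qed.

Lemma rdot_CauchySchwarz m n (A B : 'M[C]_(m, n)) :
  rdot A B ^+ 2 <= rdot A A * rdot B B.
Proof.
have [->|B0] := eqVneq B 0.
  by rewrite rdotC !rdot0l expr0n mulr0.
have BB : 0 < rdot B B by rewrite lt_def rdot_eq0 B0 rdot_ge0.
(* In the notation introduced below, this squared norm is [b * (a * b - c ^+ 2)]. *)
have := rdot_ge0 ((rdot B B)%:C *: A - (rdot A B)%:C *: B).
rewrite !(rdotDl, rdotDr, rdotNl, rdotNr, rdotZl, rdotZr) (rdotC B A).
move: BB; set a := rdot A A; set b := rdot B B; set c := rdot A B => b0 h.
have : 0 <= b * (a * b - c ^+ 2) by rewrite expr2; nra.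
by rewrite pmulr_rge0 // subr_ge0.
Qed.

Lemma rdot_mulmxl m n p (X : 'M[C]_(m, n)) (A : 'M[C]_(n, p))
    (B : 'M[C]_(m, p)) :
  rdot (X *m A) B = rdot A (X ^t* *m B).
Proof. by rewrite /rdot trmxCM mulmxA. Qed.

Lemma rdot_mulmxr m n p (A : 'M[C]_(m, n)) (X : 'M[C]_(n, p))
    (B : 'M[C]_(m, p)) :
  rdot (A *m X) B = rdot A (B *m X ^t*).
Proof. by rewrite /rdot trmxCM -mulmxA mxtrace_mulC mulmxA. Qed.

Lemma rdot_isometry m n p (U : 'M[C]_(m, n)) (A B : 'M[C]_(n, p)) :
  U ^t* *m U = 1%:M -> rdot (U *m A) (U *m B) = rdot A B.
Proof. by move=> U1; rewrite rdot_mulmxl mulmxA U1 mul1mx. Qed.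

Lemma l2normE n (v : 'cV[C]_n) : l2norm v = Num.sqrt (rdot v v).
Proof.
rewrite /l2norm rdotE; congr Num.sqrt; apply: eq_bigr => i _.
rewrite big_ord1; case: (v i ord0) => x y /=.
by rewrite sqr_sqrtr ?addr_ge0 ?sqr_ge0// !expr2.
Qed.

End RealInnerProduct.

(** * Singular values, the spectral norm and contractions *)

Section SingularValues.
Variable R : realType.
Local Notation C := R[i].

Lemma rdot_diag m n (d : 'I_m -> R) (A : 'M[C]_(m, n)) :
  rdot A (diag_mx (\row_i (d i)%:C) *m A)
  = \sum_i \sum_j d i * (complex.Re (A i j) ^+ 2 + complex.Im (A i j) ^+ 2).
Proof.
rewrite rdotE; apply: eq_bigr => i _; apply: eq_bigr => j _.
by rewrite mul_diag_mx !mxE; case: (A i j) => x y /=; ring.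
Qed.

Lemma ler_rdot_diag m n (d : 'I_m -> R) (b : R) (A : 'M[C]_(m, n)) :
  (forall i, d i <= b) ->
  rdot A (diag_mx (\row_i (d i)%:C) *m A) <= b * rdot A A.
Proof.
move=> db; rewrite rdot_diag rdotE mulr_sumr ler_sum // => i _.
rewrite mulr_sumr ler_sum // => j _.
by rewrite -!expr2 ler_wpM2r ?addr_ge0 ?sqr_ge0.
Qed.

Lemma trmxC_real_diag n (d : 'I_n -> R) :
  (diag_mx (\row_i (d i)%:C)) ^t* = diag_mx (\row_i (d i)%:C).
Proof.
rewrite tr_diag_mx map_diag_mx; congr diag_mx.
by apply/rowP => i; rewrite !mxE /= conjC_conjc conjc_real.
Qed.

Lemma rdot_diag_delta m (d : 'I_m -> R) (i : 'I_m) :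
  let e : 'cV_m := delta_mx i ord0 in
  rdot e (diag_mx (\row_i (d i)%:C) *m e) = d i.
Proof.
rewrite /= rdot_diag (bigD1 i) //= big_ord1 !mxE !eqxx /= big1 => [|k kN].
  by ring.
by rewrite big_ord1 !mxE (negPf kN) /=; ring.
Qed.

Lemma gram_hermsymmx m n (X : 'M[C]_(m, n)) : X ^t* *m X \is hermsymmx.
Proof.
by apply/is_hermitianmxP; rewrite expr0 scale1r trmxCM trmxCK.
Qed.

Lemma singval_spectral m n (X : 'M[C]_(m, n)) :
  exists P : 'M[C]_n, [/\ P ^t* *m P = 1%:M, P *m P ^t* = 1%:M &
    X ^t* *m X = P ^t* *m diag_mx (\row_i (singval X i ^+ 2)%:C) *m P].
Proof.
pose P := spectralmx (X ^t* *m X).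
have Pu : P \is unitarymx := spectral_unitarymx _.
have PP : P *m P ^t* = 1%:M by apply/unitarymxP.
exists P; split => //; first by rewrite mulmx1C.
have /orthomx_spectralP XE := hermitian_normalmx (gram_hermsymmx X).
rewrite {1}XE -/P invmx_unitary //; congr (_ *m _ *m _); congr diag_mx.
set d := spectral_diag _ in XE *.
have dE : d = \row_i (complex.Re (d ord0 i))%:C.
  apply/rowP => i; rewrite mxE.
  have /mxOverP/(_ ord0 i) := hermitian_spectral_diag_real (gram_hermsymmx X).
  by move=> dr; rewrite RRe_real.
rewrite {1}dE; apply/rowP => i; rewrite !mxE sqr_sqrtr //.
(* The eigenvalue is the squared norm of [X *m (P ^t* *m e)], hence nonnegative, so the square root
   in [singval] loses nothing. *)
rewrite -(rdot_diag_delta (fun i => complex.Re (d ord0 i))) -dE.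
rewrite (_ : diag_mx d = P *m (X ^t* *m X) *m P ^t*).
  set e := delta_mx _ _; have := rdot_ge0 (X *m (P ^t* *m e)).
  by rewrite !rdot_mulmxl trmxCK !mulmxA.
rewrite {1}XE -/P invmx_unitary // !mulmxA PP mul1mx -mulmxA PP mulmx1 //.
Qed.

Lemma singval_ge0 m n (X : 'M[C]_(m, n)) i : 0 <= singval X i.
Proof. exact: sqrtr_ge0. Qed.

Lemma singval_le_spectral_norm m n (X : 'M[C]_(m, n)) i :
  singval X i <= spectral_norm X.
Proof. exact: le_bigmax_cond. Qed.

Lemma spectral_norm_ge0 m n (X : 'M[C]_(m, n)) : 0 <= spectral_norm X.
Proof. by rewrite /spectral_norm bigmax_idl le_max lexx. Qed.

Lemma rdot_mulmx_le m n p (X : 'M[C]_(m, n)) (B : 'M[C]_(n, p)) :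
  rdot (X *m B) (X *m B) <= spectral_norm X ^+ 2 * rdot B B.
Proof.
have [P [P1 _ XX]] := singval_spectral X.
rewrite rdot_mulmxl mulmxA XX -!mulmxA -rdot_mulmxl.
rewrite -(rdot_isometry B B P1).
apply: ler_rdot_diag => i.
by rewrite ler_sqr ?nnegrE ?singval_ge0 ?spectral_norm_ge0
  ?singval_le_spectral_norm.
Qed.

(** Quantifying over matrices [B] of any width lets the bound apply to whole blocks of columns and
    makes composition immediate. *)
Definition nonexpansive m n (X : 'M[C]_(m, n)) :=
  forall p (B : 'M[C]_(n, p)), rdot (X *m B) (X *m B) <= rdot B B.

Lemma rdot_unitary_delta n (P : 'M[C]_n) i : P *m P ^t* = 1%:M ->
  rdot (P ^t* *m (delta_mx i ord0 : 'cV_n)) (P ^t* *m delta_mx i ord0) = 1.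
Proof.
move=> P2; rewrite rdot_isometry ?trmxCK //.
rewrite -[RHS](rdot_diag_delta (fun=> 1) i) (_ : diag_mx _ = 1%:M) ?mul1mx //.
by apply/matrixP => k l; rewrite !mxE.
Qed.

(** The columns of [P ^t*] are right singular vectors of [X]. *)
Lemma rdot_singval m n (X : 'M[C]_(m, n)) (P : 'M[C]_n) i : P *m P ^t* = 1%:M ->
  X ^t* *m X = P ^t* *m diag_mx (\row_i (singval X i ^+ 2)%:C) *m P ->
  rdot (X *m (P ^t* *m (delta_mx i ord0 : 'cV_n)))
       (X *m (P ^t* *m delta_mx i ord0)) = singval X i ^+ 2.
Proof.
move=> P2 XX; rewrite rdot_mulmxl (mulmxA (X ^t*)) XX -!mulmxA (mulmxA P) P2.
rewrite mul1mx rdot_isometry ?trmxCK //.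
exact: rdot_diag_delta (fun i => singval X i ^+ 2) i.
Qed.

(** For the converse, it is enough to test [X] on its right singular vectors. *)
Lemma spectral_norm_le1P m n (X : 'M[C]_(m, n)) :
  spectral_norm X <= 1 <-> nonexpansive X.
Proof.
split=> [X1 p B|XC].
  apply: le_trans (rdot_mulmx_le X B) _.
  by rewrite ler_piMl ?rdot_ge0 // expr_le1 // spectral_norm_ge0.
apply/bigmax_leP; split => // i _.
have [P [_ P2 XX]] := singval_spectral X.
have := XC _ (P ^t* *m delta_mx i (ord0 : 'I_1)).
rewrite rdot_singval // rdot_unitary_delta // => h.
by rewrite -(expr_le1 (n := 2)) ?singval_ge0.
Qed.

Lemma rdot_le_of_sqr m n (A : 'M[C]_(m, n)) (b : R) :
  0 <= b -> rdot A A ^+ 2 <= b * rdot A A -> rdot A A <= b.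
Proof.
move=> b0; have := rdot_ge0 A; rewrite le_eqVlt => /predU1P[<- //|A0].
by rewrite expr2 ler_pM2r.
Qed.

(** Cauchy-Schwarz gives [|Y|^4 <= |B|^2 |X Y|^2 <= |B|^2 |Y|^2] for [Y = X^* B], and a factor
    [|Y|^2] cancels. *)
Lemma nonexpansive_trmxC m n (X : 'M[C]_(m, n)) :
  nonexpansive X -> nonexpansive (X ^t*).
Proof.
move=> XC p B; set Y := X ^t* *m B.
apply: rdot_le_of_sqr; first exact: rdot_ge0.
have h : rdot Y Y = rdot B (X *m Y) by rewrite {1}/Y rdot_mulmxl trmxCK.
have := rdot_CauchySchwarz B (X *m Y); rewrite -h => cs.
by apply: le_trans cs _; rewrite ler_wpM2l ?rdot_ge0.
Qed.

Lemma nonexpansive_lt m n p (X : 'M[C]_(m, n)) (B : 'M[C]_(n, p)) :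
  spectral_norm X < 1 -> B != 0 -> rdot (X *m B) (X *m B) < rdot B B.
Proof.
move=> X1 B0; apply: le_lt_trans (rdot_mulmx_le X B) _.
have BB : 0 < rdot B B by rewrite lt_def rdot_eq0 B0 rdot_ge0.
by rewrite gtr_pMl // expr_lt1 // spectral_norm_ge0.
Qed.

(** The argument of [nonexpansive_trmxC] with [|X Y| < |Y|], which requires [Y != 0]; hence the case
    split. *)
Lemma nonexpansive_lt_trmxC m n p (X : 'M[C]_(m, n)) (B : 'M[C]_(m, p)) :
  spectral_norm X < 1 -> B != 0 -> rdot (X ^t* *m B) (X ^t* *m B) < rdot B B.
Proof.
move=> X1 B0; set Y := X ^t* *m B.
have [->|Y0] := eqVneq Y 0.
  by rewrite rdot0l lt_def rdot_eq0 B0 rdot_ge0.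
have YY : 0 < rdot Y Y by rewrite lt_def rdot_eq0 Y0 rdot_ge0.
have BB : 0 < rdot B B by rewrite lt_def rdot_eq0 B0 rdot_ge0.
have h : rdot Y Y = rdot B (X *m Y) by rewrite {1}/Y rdot_mulmxl trmxCK.
have := rdot_CauchySchwarz B (X *m Y); rewrite -h => cs.
have : rdot Y Y ^+ 2 < rdot B B * rdot Y Y.
  by apply: le_lt_trans cs _; rewrite ltr_pM2l ?nonexpansive_lt.
by rewrite expr2 ltr_pM2r.
Qed.

Lemma nonexpansive_isometry m n (U : 'M[C]_(m, n)) :
  U ^t* *m U = 1%:M -> nonexpansive U.
Proof. by move=> U1 p B; rewrite rdot_isometry. Qed.

Lemma nonexpansiveM m n p (X : 'M[C]_(m, n)) (Y : 'M[C]_(n, p)) :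
  nonexpansive X -> nonexpansive Y -> nonexpansive (X *m Y).
Proof. by move=> XC YC q B; rewrite -mulmxA (le_trans (XC _ _)). Qed.

End SingularValues.

(** * The nuclear norm as a maximum over contractions *)

Section NuclearNorm.
Variable R : realType.
Local Notation C := R[i].

Lemma rdot_col m n (A B : 'M[C]_(m, n)) :
  rdot A B = \sum_j rdot (col j A) (col j B).
Proof.
rewrite rdotE exchange_big; apply: eq_bigr => j _ /=; rewrite rdotE.
by apply: eq_bigr => i _; rewrite big_ord1 !mxE.
Qed.

Lemma rdot_le_norm m n (A B : 'M[C]_(m, n)) (b : R) :
  rdot A A <= 1 -> rdot B B <= b ^+ 2 -> 0 <= b -> rdot A B <= b.
Proof.
move=> A1 Bb b0; rewrite leNgt; apply/negP => bAB.
have := rdot_CauchySchwarz A B; rewrite leNgt => /negP; apply.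
apply: (@le_lt_trans _ _ (1 * b ^+ 2)); first by rewrite ler_pM ?rdot_ge0.
by rewrite mul1r ltr_sqr ?nnegrE // (le_trans b0) // ltW.
Qed.

(** In the orthonormal basis of right singular vectors [v_i], the pairing is the sum of the
    [<Q v_i, X v_i>], where [|Q v_i| <= 1] and [|X v_i|] is the singular value. *)
Lemma rdot_le_nuclear m n (Q X : 'M[C]_(m, n)) :
  nonexpansive Q -> rdot Q X <= nuclear_norm X.
Proof.
move=> QC; have [P [P1 P2 XX]] := singval_spectral X.
rewrite -[X in rdot _ X](mulmx1 X) -P1 mulmxA.
rewrite -[Y in _ *m Y](trmxCK P) -rdot_mulmxr rdot_col; apply: ler_sum => i _.
rewrite !colE -!mulmxA.
apply: rdot_le_norm; [ | | exact: singval_ge0].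
  by apply: le_trans (QC _ _) _; rewrite rdot_unitary_delta.
by rewrite rdot_singval.
Qed.

Lemma nuclear_attained m n (X : 'M[C]_(m, n)) :
  exists2 Q, nonexpansive Q & rdot Q X = nuclear_norm X.
Proof.
have [P [P1 P2 XX]] := singval_spectral X.
(* Since [0^-1 = 0], [T] is the pseudo-inverse of the singular values, and the
   witness is the partial isometry of the polar decomposition of [X]. *)
pose T : 'M[C]_n := diag_mx (\row_i ((singval X i)^-1)%:C).
have TT : T ^t* = T := trmxC_real_diag _.
exists (X *m (P ^t* *m (T *m P))) => [p B|].
  rewrite -(rdot_isometry B B P1) -!mulmxA rdot_mulmxl.
  rewrite (mulmxA (X ^t*) X) XX -!mulmxA (mulmxA P) P2 mul1mx.
  rewrite (@rdot_isometry _ _ _ _ (P ^t*)) ?trmxCK // (rdot_mulmxl T) TT.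
  move: (P *m B) => A; rewrite !mulmxA !mulmx_diag.
  set d := \row_i _.
  (* [d] is the spectrum of the Gram matrix of the witness, which is an orthogonal projection. *)
  have -> : d = \row_i (singval X i != 0)%:R%:C.
    apply/rowP => i; rewrite !mxE -!rmorphM /=; congr _%:C.
    case: eqVneq => [->|s0]; first by rewrite expr0n !mulr0 ?mul0r.
    by rewrite expr2 mulKf ?divff.
  rewrite -[X in _ <= X]mul1r; apply: ler_rdot_diag => i.
  by case: eqVneq; rewrite ?ler01.
rewrite rdot_mulmxl XX.
rewrite -!mulmxA rdot_isometry ?trmxCK // rdot_mulmxr -mulmxA P2 mulmx1.
rewrite rdotE; apply: eq_bigr => i _; rewrite (bigD1 i) //= big1 => [|j jN].
  rewrite !mxE eqxx /= mul0r !addr0.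
  case: (eqVneq (singval X i) 0) => [->|s0]; first by rewrite expr0n mulr0.
  by rewrite expr2 mulKf.
by rewrite !mxE eq_sym (negPf jN) /= !mul0r addr0.
Qed.

End NuclearNorm.

(** * Hahn-Banach by successive sublinear minorants *)

Section HahnBanach.
Variables (R : realType) (V : lmodType R[i]).

(** Homogeneity concerns real scalars only, so the complex space serves as a real one. The
    inequality suffices: [sublinearZ] gets equality by rescaling with [a^-1]. *)
Definition sublinear (p : V -> R) :=
  (forall x y, p (x + y) <= p x + p y) /\
  (forall (a : R) x, 0 <= a -> p (a%:C *: x) <= a * p x).

Lemma sublinear0 p : sublinear p -> p 0 = 0.
Proof.
case=> pD pZ; have := pD 0 0; have := pZ 0 0 (lexx _).
by rewrite mul0r scaler0 addr0 => ? ?; lra.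
Qed.

Lemma sublinearZ p (a : R) x : sublinear p -> 0 <= a -> p (a%:C *: x) = a * p x.
Proof.
move=> pS; rewrite le_eqVlt => /predU1P[<-|a0].
  by rewrite scale0r mul0r sublinear0.
case: pS => _ pZ; apply: le_anti; rewrite pZ ?(ltW a0) //=.
have aV0 : 0 <= a^-1 by rewrite invr_ge0 ltW.
have := pZ _ (a%:C *: x) aV0.
by rewrite scalerA -rmorphM mulVf ?gt_eqF // scale1r ler_pdivlMl.
Qed.

(* An element [(c, a)] stands for the constraint [q (- c) <= - a], which forces
   [a <= q c]: the largest sublinear minorant [q] of [p] satisfying all of them
   is [q x = inf (p (x + c) - a)]. *)
Definition cone (D : set (V * R)) :=
  [/\ D (0, 0), forall c d, D c -> D d -> D (c.1 + d.1, c.2 + d.2)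
    & forall (a : R) c, 0 <= a -> D c -> D (a%:C *: c.1, a * c.2)].

Lemma sublinear_minorant p D : sublinear p -> cone D ->
  (forall c, D c -> c.2 <= p c.1) ->
  exists q, [/\ sublinear q, forall x, q x <= p x
              & forall c, D c -> q (- c.1) <= - c.2].
Proof.
move=> pS; have p0 := sublinear0 pS; case: pS => pD pZ [D0 DD DZ] Dp.
pose E x := [set p (x + c.1) - c.2 | c in D].
(* Subadditivity at [c.1 = (x + c.1) - x], together with [c.2 <= p c.1], keeps the infimum
   finite. *)
have lbE x : has_lbound (E x).
  exists (- p (- x)) => _ [c Dc <-].
  have := pD (x + c.1) (- x); rewrite addrAC subrr add0r.
  by have := Dp _ Dc; lra.
have E0 x : E x !=set0 by exists (p (x + 0) - 0), (0, 0).
have infE x : has_inf (E x) by [].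
pose q x := inf (E x).
have qle x c : D c -> q x <= p (x + c.1) - c.2.
  by move=> Dc; apply: ge_inf => //; exists c.
have qge x y : (forall c, D c -> y <= p (x + c.1) - c.2) -> y <= q x.
  by move=> h; apply: lb_le_inf => // _ [c Dc <-]; exact: h.
exists q; split.
- split=> [x y|a x].
    rewrite -lerBlDr; apply: (qge) => c Dc; rewrite lerBlDr -lerBlDl.
    apply: (qge) => d Dd; rewrite lerBlDl.
    apply: le_trans (qle _ _ (DD _ _ Dc Dd)) _ => /=.
    have := pD (x + c.1) (y + d.1); rewrite addrACA; lra.
  rewrite le_eqVlt => /predU1P[<-|a0].
    rewrite mul0r scale0r; apply: le_trans (qle _ _ D0) _ => /=.
    by rewrite addr0 p0 subr0.
  rewrite -ler_pdivrMl //; apply: (qge) => c Dc; rewrite ler_pdivrMl //.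
  apply: le_trans (qle _ _ (DZ _ _ (ltW a0) Dc)) _ => /=.
  by rewrite -scalerDr mulrBr lerB // pZ // ltW.
- by move=> x; apply: le_trans (qle _ _ D0) _ => /=; rewrite addr0 subr0.
- move=> c Dc; apply: le_trans (qle _ _ Dc) _ => /=.
  by rewrite addNr p0 add0r.
Qed.

(* A sublinear [q] with [q (- e) <= - q e] is linear along [e], so treating a
   basis this way produces a linear minorant.  Passing to a smaller sublinear
   function preserves the property for the vectors already treated. *)
Lemma sublinear_odd_seq p (s : seq V) : sublinear p ->
  exists q, [/\ sublinear q, forall x, q x <= p x
              & forall e, e \in s -> q (- e) <= - q e].
Proof.
move=> pS; elim: s => [|e s [q [qS qp qs]]]; first by exists p; split.
(* The ray through [(e, q e)] yields [r (- e) <= - q e], and [r <= q] turns this into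
   [r (- e) <= - r e]. *)
have [|_ [a /= a0 <-]|r [rS rq re]] :=
    @sublinear_minorant q
      [set (a%:C *: e, a * q e) | a in [set a : R | 0 <= a]] qS.
- split.
  + by exists 0 => //=; rewrite scale0r mul0r.
  + move=> _ _ [a /= a0 <-] [b /= b0 <-]; exists (a + b); first exact: addr_ge0.
    by rewrite rmorphD scalerDl mulrDl.
  + move=> b _ b0 [a /= a0 <-]; exists (b * a); first exact: mulr_ge0.
    by rewrite rmorphM scalerA mulrA.
- by rewrite /= sublinearZ.
exists r; split=> [//|x|f]; first exact: le_trans (qp x).
rewrite inE => /predU1P[->|fs].
  have := re (1%:C *: e, 1 * q e); rewrite /= !scale1r !mul1r => h.
  apply: le_trans (h _) _; last by rewrite lerN2.
  by exists 1; rewrite ?scale1r ?mul1r /=.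
by apply: le_trans (rq _) _; apply: le_trans (qs _ fs) _; rewrite lerN2.
Qed.

Lemma sublinear_odd_sum (p : V -> R) (I : eqType) (s : seq I) (e : I -> V)
    (t : I -> R) x :
  sublinear p -> (forall i, i \in s -> p (- e i) <= - p (e i)) ->
  p (x + \sum_(i <- s) (t i)%:C *: e i) = p x + \sum_(i <- s) t i * p (e i).
Proof.
move=> pS pe; have [pD _] := pS.
have odd1 y i (a : R) : i \in s -> p (y + a%:C *: e i) = p y + a * p (e i).
  move=> /pe pei; have pN : p (- e i) = - p (e i).
    by have := pD (e i) (- e i); rewrite subrr sublinear0 //; lra.
  have pZ : p (a%:C *: e i) = a * p (e i).
    have [a0|a0] := leP 0 a; first by rewrite sublinearZ.
    rewrite -[a]opprK rmorphN scaleNr -scalerN.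
    rewrite sublinearZ ?oppr_ge0 ?(ltW a0) // pN.
    by rewrite mulrN !mulNr.
  have pNZ : p (- (a%:C *: e i)) = - (a * p (e i)).
    have [a0|a0] := leP 0 a; first by rewrite -scalerN sublinearZ // pN mulrN.
    by rewrite -scaleNr -rmorphN sublinearZ ?oppr_ge0 ?(ltW a0) // mulNr.
  (* Subadditivity for [y + a e] and for [y = (y + a e) - a e] gives the two inequalities. *)
  have := pD y (a%:C *: e i); have := pD (y + a%:C *: e i) (- (a%:C *: e i)).
  by rewrite addrK pZ pNZ; lra.
elim: s pe odd1 x => [|i s IH] pe odd1 x; first by rewrite !big_nil !addr0.
rewrite !big_cons addrA IH => [|j js|y j a js].
- by rewrite odd1 ?mem_head // addrA.
- by rewrite pe // inE js orbT.
- by rewrite odd1 // inE js orbT.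
Qed.

End HahnBanach.

(** * Dual certificates of minimality *)

Section DualCertificate.
Variable R : realType.
Local Notation C := R[i].

(** A minorant that is odd along the real basis [E_ij], [i E_ij] is real-linear, and its values
    there are the real and imaginary parts of the entries of [Q]. *)
Lemma sublinear_rdot m n (p : 'M[C]_(m, n) -> R) : sublinear p ->
  exists Q, forall X, rdot Q X <= p X.
Proof.
move=> pS.
pose e (k : 'I_m * 'I_n) : 'M[C]_(m, n) := delta_mx k.1 k.2.
pose f k : 'M[C]_(m, n) := 'i%C *: e k.
have [q [qS qp qodd]] :=
  sublinear_odd_seq (codom e ++ codom f) pS.
exists (\matrix_(i, j) (q (e (i, j)) +i* q (f (i, j)))) => X.
apply: le_trans (qp X).
have XE : X = 0 + \sum_k (complex.Re (X k.1 k.2))%:C *: e k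
                + \sum_k (complex.Im (X k.1 k.2))%:C *: f k.
  rewrite {1}[X]matrix_sum_delta pair_big add0r -big_split /=.
  apply: eq_bigr => -[i j] _ /=.
  rewrite /f scalerA -scalerDl; congr (_ *: _).
  by rewrite [LHS]complexE mulrC.
rewrite [in leRHS]XE !sublinear_odd_sum // ?sublinear0 //; first last.
- by move=> k _; rewrite qodd // mem_cat codom_f orbT.
- by move=> k _; rewrite qodd // mem_cat codom_f.
rewrite add0r -big_split rdotE pair_big /= le_eqVlt; apply/orP; left; apply/eqP.
by apply: eq_bigr => -[i j] _; rewrite !mxE /= mulrC [X in _ + X]mulrC.
Qed.

(** The contraction attaining the norm on the left is a competitor for each term on the right. *)
Lemma nuclear_sublinear m n : sublinear (@nuclear_norm R m n).
Proof.
split=> [X Y|a X a0].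
  have [Q QC <-] := nuclear_attained (X + Y).
  by rewrite rdotDr lerD // rdot_le_nuclear.
have [Q QC <-] := nuclear_attained (a%:C *: X).
by rewrite rdotZr ler_wpM2l // rdot_le_nuclear.
Qed.

(** Test on [X = Q B B^*]: if the contraction [P] attains its nuclear norm, then
    [|Q B|^2 <= <P B, Q B> <= |B| |Q B|]. *)
Lemma nonexpansive_nuclear m n (Q : 'M[C]_(m, n)) :
  (forall X, rdot Q X <= nuclear_norm X) -> nonexpansive Q.
Proof.
move=> QX p B; apply: rdot_le_of_sqr; first exact: rdot_ge0.
have [P PC PE] := nuclear_attained (Q *m B *m B ^t*).
have := QX (Q *m B *m B ^t*); rewrite -PE -!rdot_mulmxr => h.
apply: (@le_trans _ _ (rdot (P *m B) (Q *m B) ^+ 2)).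
  by rewrite ler_sqr ?nnegrE ?rdot_ge0 // (le_trans _ h) // rdot_ge0.
by apply: le_trans (rdot_CauchySchwarz _ _) _; rewrite ler_wpM2r ?rdot_ge0.
Qed.

Lemma dual_certificate m n (L : set 'M[C]_(m, n)) (X : 'M[C]_(m, n)) :
  L 0 -> (forall (a : R) A B, L A -> L B -> L (a%:C *: A + B)) ->
  (forall A, L A -> nuclear_norm X <= nuclear_norm (X + A)) ->
  exists Q, [/\ nonexpansive Q, forall A, L A -> rdot Q A = 0
              & rdot Q X = nuclear_norm X].
Proof.
move=> L0 LD Xmin; have nS := @nuclear_sublinear m n.
have LZ (a : R) A : L A -> L (a%:C *: A).
  by move=> LA; rewrite -[_ *: _]addr0; apply: LD.
(* The constraints with [t = 0] will force the functional to vanish on [L], and the one with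
   [A = 0], [t = 1] to reach [nuclear_norm X] at [X]. *)
pose D : set ('M[C]_(m, n) * R) :=
  [set c | exists A t,
     [/\ L A, 0 <= t & c = (A + t%:C *: X, t * nuclear_norm X)]].
have Dcone : cone D.
  split.
  - by exists 0, 0; rewrite scale0r mul0r addr0.
  - move=> _ _ [A [t [LA t0 ->]]] [B [u [LB u0 ->]]] /=.
    exists (A + B), (t + u); split; [|exact: addr_ge0|].
      by rewrite -[A]scale1r; apply: (LD 1).
    by rewrite rmorphD scalerDl mulrDl addrACA.
  - move=> a _ a0 [A [t [LA t0 ->]]] /=.
    exists (a%:C *: A), (a * t); split; [exact: LZ | exact: mulr_ge0 |].
    by rewrite rmorphM scalerDr scalerA mulrA.
have [c [A [t [LA t0 ->]]]|q [qS qn qD]] := sublinear_minorant nS Dcone.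
  move: t0; rewrite le_eqVlt => /predU1P[<-|t0] /=.
    by rewrite mul0r sumr_ge0 // => i _; exact: singval_ge0.
  (* Dividing by [t] reduces the constraint to the minimality of [X]. *)
  have -> : A + t%:C *: X = t%:C *: (X + t^-1%:C *: A).
    by rewrite scalerDr scalerA -rmorphM divff ?gt_eqF // scale1r addrC.
  by rewrite sublinearZ ?(ltW t0) // ler_wpM2l ?(ltW t0) // Xmin //; apply: LZ.
have [Q Qq] := sublinear_rdot qS; exists Q; split.
- by apply: nonexpansive_nuclear => A; apply: le_trans (Qq _) _.
(* One sign is enough, as [L] is stable under negation. *)
- have le0 A : L A -> 0 <= rdot Q A.
    move=> LA; rewrite -oppr_le0 -rdotNr; apply: le_trans (Qq _) _.
    apply: le_trans (qD (A, 0) _) _; last by rewrite oppr0.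
    by exists A, 0; rewrite scale0r mul0r addr0.
  move=> A LA; apply: le_anti; rewrite le0 // andbT -oppr_ge0 -rdotNr -scaleN1r.
  by rewrite -(rmorphN1 (real_complex R)) le0 //; apply: LZ.
- apply: le_anti; rewrite (le_trans (Qq _) (qn _)) -lerN2 -rdotNr.
  apply: le_trans (Qq _) _; apply: (qD (X, nuclear_norm X)).
  by exists 0, 1; rewrite scale1r mul1r add0r.
Qed.

End DualCertificate.

(** * Strong duality, the decomposition of the dual solution and the atoms *)

Section DualPolynomial.
Variable R : realType.
Local Notation C := R[i].

Lemma rdot_restrict m n (Omega : {set 'I_m * 'I_n}) (A B : 'M[C]_(m, n)) :
  rdot (restrict_to Omega A) (restrict_to Omega B)
  = rdot (restrict_to Omega A) B.
Proof.
rewrite !rdotE; apply: eq_bigr => i _; apply: eq_bigr => j _.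
by rewrite !mxE; case: ifP => //= _; rewrite !mul0r.
Qed.

Lemma restrict_toD m n (Omega : {set 'I_m * 'I_n}) (A B : 'M[C]_(m, n)) :
  restrict_to Omega (A + B) = restrict_to Omega A + restrict_to Omega B.
Proof. by apply/matrixP => i j; rewrite !mxE; case: ifP; rewrite ?addr0. Qed.

Lemma restrict_toZ m n (Omega : {set 'I_m * 'I_n}) a (A : 'M[C]_(m, n)) :
  restrict_to Omega (a *: A) = a *: restrict_to Omega A.
Proof. by apply/matrixP => i j; rewrite !mxE; case: ifP; rewrite ?mulr0. Qed.

Lemma restrict_to_id m n (Omega : {set 'I_m * 'I_n}) (A : 'M[C]_(m, n)) :
  restrict_to Omega (restrict_to Omega A) = restrict_to Omega A.
Proof. by apply/matrixP => i j; rewrite !mxE; case: (_ \in _). Qed.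

Lemma strong_duality m n (Omega : {set 'I_m * 'I_n}) (Xs X Q : 'M[C]_(m, n)) :
  primal_solution Omega Xs X -> dual_solution Omega Xs Q ->
  nuclear_norm X <= rdot (restrict_to Omega Q) X.
Proof.
move=> [XXs Xmin] [_ Qmax].
have [||A LA|P [PC PL PX]] :=
  @dual_certificate _ _ _ [set A | restrict_to Omega A = 0] X.
- by apply/matrixP => i j; rewrite !mxE; case: ifP.
- move=> a A B /= LA LB.
  by rewrite restrict_toD restrict_toZ LA LB scaler0 addr0.
- by apply: Xmin; rewrite restrict_toD LA addr0.
(* [restrict_to Omega P - P] vanishes on [Omega], so it is orthogonal to [P] by the certificate and
   to [restrict_to Omega P] by disjointness of supports. *)
have PO : restrict_to Omega P = P.
  apply/eqP; rewrite -subr_eq0 -rdot_eq0; apply/eqP.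
  have PL0 : restrict_to Omega (restrict_to Omega P - P) = 0.
    rewrite -scaleN1r restrict_toD restrict_toZ restrict_to_id.
    by rewrite scaleN1r subrr.
  by rewrite rdotDl rdotNl (PL _ PL0) -rdot_restrict PL0 rdotC rdot0l subr0.
have := Qmax P; rewrite PO spectral_norm_le1P => /(_ PC).
rewrite /dual_objective -!/(rdot _ _) !rdot_restrict.
(* [X] and [Xs] agree on [Omega], so both objectives can be evaluated at [X]. *)
by rewrite -!(rdot_restrict _ _ Xs) -XXs !rdot_restrict PO PX.
Qed.

Lemma aligned_singular_vectors m n p (P X : 'M[C]_(m, n)) (U : 'M[C]_(m, p))
    (s : 'rV[R]_p) (V : 'M[C]_(n, p)) :
  nonexpansive P -> truncated_svd X U s V -> nuclear_norm X <= rdot P X ->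
  P *m V = U /\ P ^t* *m U = V.
Proof.
move=> PC [U1 V1 s0 XE] Xle.
pose S := diag_mx (map_mx (real_complex R) s).
pose T : 'M[C]_p := diag_mx (\row_i (Num.sqrt (s ord0 i))%:C).
have TT : T ^t* = T := trmxC_real_diag _.
have ST : S = T *m T.
  rewrite mulmx_diag; congr diag_mx; apply/rowP => i.
  by rewrite !mxE -rmorphM -expr2 sqr_sqrtr // ltW.
have Tu : T \in unitmx.
  rewrite unitmxE det_diag unitfE; apply/prodf_neq0 => i _; rewrite mxE.
  by rewrite fmorph_eq0 gt_eqF // sqrtr_gt0.
(* Comparing with the contraction [U V^*] replaces the identification of [nuclear_norm X] with the
   sum of [s]. *)
have UVX : rdot (U *m V ^t*) X <= rdot P X.
  apply: le_trans Xle; apply: rdot_le_nuclear; apply: nonexpansiveM.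
    exact: nonexpansive_isometry.
  exact/nonexpansive_trmxC/nonexpansive_isometry.
(* Scaling by [T], the square root of the singular values, makes the equality
   case of Cauchy-Schwarz an estimate of [|(P V - U) T|^2]. *)
have PV : P *m V = U.
  apply/eqP; rewrite -subr_eq0; apply/eqP.
  rewrite -[LHS](mulmxK Tu); suff -> : (P *m V - U) *m T = 0 by rewrite mul0mx.
  apply: rdot_le0; rewrite mulmxBl !(rdotDl, rdotDr, rdotNl, rdotNr).
  rewrite (rdotC (U *m T)) (rdot_isometry _ _ U1) -mulmxA.
  have := PC _ (V *m T); rewrite (rdot_isometry _ _ V1).
  suff : rdot T T <= rdot (P *m (V *m T)) (U *m T) by lra.
  have USE A : rdot A (U *m S) = rdot (A *m T) (U *m T).
    by rewrite rdot_mulmxr TT -mulmxA -ST.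
  move: UVX; rewrite XE -/S -!rdot_mulmxr !USE -(mulmxA U) V1 mulmx1.
  by rewrite (rdot_isometry _ _ U1) -mulmxA.
(* Now [<P^* U, V> = <U, P V> = |U|^2 = |V|^2] and [|P^* U| <= |U|], so [|P^* U - V|^2 <= 0]. *)
have UV : rdot U U = rdot V V.
  by rewrite -[U]mulmx1 -[V]mulmx1 !rdot_isometry.
have PUV : rdot (P ^t* *m U) V = rdot V V by rewrite rdot_mulmxl trmxCK PV.
split=> //; apply/eqP; rewrite -subr_eq0; apply/eqP; apply: rdot_le0.
rewrite !(rdotDl, rdotDr, rdotNl, rdotNr) (rdotC V) PUV.
by have := nonexpansive_trmxC PC U; rewrite UV; lra.
Qed.

Lemma dual_decomposition_exists m n p (Omega : {set 'I_m * 'I_n})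
    (Q : 'M[C]_(m, n)) (U : 'M[C]_(m, p)) (V : 'M[C]_(n, p)) :
  U ^t* *m U = 1%:M -> V ^t* *m V = 1%:M ->
  nonexpansive (restrict_to Omega Q) ->
  restrict_to Omega Q *m V = U -> (restrict_to Omega Q) ^t* *m U = V ->
  exists W, dual_decomposition Omega Q U V W.
Proof.
set P := restrict_to Omega Q => U1 V1 PC PV PU.
exists (P - U *m V ^t*); split.
- by rewrite addrC subrK.
- by rewrite mulmxBr mulmxA U1 mul1mx -PU trmxCM trmxCK subrr.
- by rewrite mulmxBl -mulmxA V1 mulmx1 PV subrr.
apply/spectral_norm_le1P => q B.
have -> : (P - U *m V ^t*) *m B = P *m (B - V *m (V ^t* *m B)).
  by rewrite mulmxBl mulmxBr !mulmxA PV.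
apply: le_trans (PC _ _) _.
rewrite !(rdotDl, rdotDr, rdotNl, rdotNr) (rdotC B) rdot_isometry //.
by rewrite (rdot_mulmxl V); have := rdot_ge0 (V ^t* *m B); lra.
Qed.

Lemma rdot_avec M (r f : R) : (0 < M)%N -> 0 <= r <= 1 ->
  rdot (avec M r f) (avec M r f) = 1.
Proof.
move=> M0 /andP[r0 r1].
(* The phases have modulus 1, which leaves a geometric series in [r ^+ 2]. *)
have -> : rdot (avec M r f) (avec M r f)
          = avec_scale M r ^+ 2 * \sum_(m < M) (r ^+ 2) ^+ m.
  rewrite rdotE mulr_sumr; apply: eq_bigr => m _; rewrite big_ord1 !mxE.
  rewrite /expi; set t := _ * m%:R => /=.
  have := cos2Dsin2 t; rewrite -exprM mulnC exprM.
  move: (cos t) (sin t) (r ^+ m) => x y z xy /=.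
  rewrite -[RHS]mulr1 -xy; ring.
rewrite /avec_scale; have [rlt|rge] := ltP r 1; last first.
  have -> : r = 1 by apply: le_anti; rewrite r1.
  rewrite expr1n (eq_bigr (fun=> 1)) => [|m _]; last by rewrite expr1n.
  rewrite sumr_const card_ord exprVn sqr_sqrtr ?ler0n // mulVf //.
  by rewrite pnatr_eq0 -lt0n.
have r2 : 0 < 1 - r ^+ 2 by rewrite subr_gt0 expr_lt1.
have r2M : 0 < 1 - r ^+ (2 * M) by rewrite subr_gt0 expr_lt1 // muln_gt0.
have -> : \sum_(m < M) (r ^+ 2) ^+ m = (1 - r ^+ (2 * M)) / (1 - r ^+ 2).
  apply: (canRL (mulfK _)); first by rewrite gt_eqF.
  by rewrite -[RHS]opprB exprM subrX1 -(mulNr (_ - _)) opprB mulrC.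
rewrite sqr_sqrtr; last by rewrite divr_ge0 // ltW.
by field; rewrite !gt_eqF.
Qed.

(** Pythagoras: [W V = 0] makes the ranges of [V] and [W^*] orthogonal, and [V] preserves norms. *)
Lemma rdot_dual_decomposition M N p q (U : 'M[C]_(M, p)) (V : 'M[C]_(N, p))
    (W : 'M[C]_(M, N)) (a : 'M[C]_(M, q)) :
  V ^t* *m V = 1%:M -> W *m V = 0 ->
  rdot ((U *m V ^t* + W) ^t* *m a) ((U *m V ^t* + W) ^t* *m a)
  = rdot (U ^t* *m a) (U ^t* *m a) + rdot (W ^t* *m a) (W ^t* *m a).
Proof.
move=> V1 WV.
have -> : (U *m V ^t* + W) ^t* *m a = V *m (U ^t* *m a) + W ^t* *m a.
  by rewrite linearD /= map_mxD mulmxDl trmxCM trmxCK -mulmxA.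
rewrite !(rdotDl, rdotDr) (rdotC (W ^t* *m a)) rdot_isometry //.
rewrite (rdot_mulmxl V _ (W ^t* *m a)) (mulmxA (V ^t*)) -trmxCM WV.
rewrite trmx0 map_mx0 mul0mx (rdotC _ 0) rdot0l; ring.
Qed.

End DualPolynomial.

Theorem theorem4p2 (R : realType) (M N K : nat)
    (M_gt0 : (0 < M)%N) (N_gt0 : (0 < N)%N) (K_gt0 : (0 < K)%N)
    (rs fs : 'I_K -> R) (c : 'I_K -> R[i]) (phi : 'I_K -> 'cV[R[i]]_N)
    (rs01 : forall k, 0 <= rs k <= 1) (fs01 : forall k, 0 <= fs k < 1)
    (distinct : injective (fun k => (rs k, fs k)))
    (c_neq0 : forall k, c k != 0) (phi_unit : forall k, l2norm (phi k) = 1)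
    (Omega : {set 'I_M * 'I_N})
    (Xs : 'M[R[i]]_(M, N)) (XsE : Xs = data_matrix M rs fs c phi)
    (Xhat : 'M[R[i]]_(M, N)) (Xhat_sol : primal_solution Omega Xs Xhat)
    (p : nat) (U : 'M[R[i]]_(M, p)) (s : 'rV[R]_p) (V : 'M[R[i]]_(N, p))
    (Xhat_svd : truncated_svd Xhat U s V)
    (Q : 'M[R[i]]_(M, N)) (Q_sol : dual_solution Omega Xs Q) :
  (exists W : 'M[R[i]]_(M, N), dual_decomposition Omega Q U V W) /\
  (forall W : 'M[R[i]]_(M, N), dual_decomposition Omega Q U V W ->
    Q = restrict_to Omega Q ->
    colspace Xs `<=` colspace Xhat ->
    spectral_norm W < 1 ->
    [/\ colspace Xs = colspace (A_rf M rs fs) ->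
          forall r f : R, 0 <= r <= 1 -> 0 <= f < 1 ->
            RF_pairs rs fs (r, f) -> l2norm (dual_poly Q r f) = 1,
        forall r f : R, 0 <= r <= 1 -> 0 <= f < 1 ->
          ~ RF_pairs rs fs (r, f) -> colspace U (avec M r f) ->
          l2norm (dual_poly Q r f) = 1
      & forall r f : R, 0 <= r <= 1 -> 0 <= f < 1 ->
          ~ RF_pairs rs fs (r, f) -> ~ colspace U (avec M r f) ->
          l2norm (dual_poly Q r f) < 1]).
Proof.
have [U1 V1 s0 XhatE] := Xhat_svd.
split.
  have QC : nonexpansive (restrict_to Omega Q).
    by apply/spectral_norm_le1P; case: Q_sol.
  have [PV PU] :=
    aligned_singular_vectors QC Xhat_svd (strong_duality Xhat_sol Q_sol).
  exact: dual_decomposition_exists.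
move=> W [QE UW WV _] QO subX W1; rewrite -QO in QE.
have WU : W ^t* *m U = 0 by rewrite -[U]trmxCK -trmxCM UW trmx0 map_mx0.
have on_range r f : 0 <= r <= 1 -> colspace U (avec M r f) ->
    l2norm (dual_poly Q r f) = 1.
  move=> r01 [x _ xE]; rewrite l2normE /dual_poly QE rdot_dual_decomposition //.
  rewrite -xE !mulmxA U1 mul1mx WU.
  rewrite mul0mx rdot0l addr0 -(rdot_isometry x x U1) xE rdot_avec //.
  exact: sqrtr1.
split=> [XsA r f r01 _ [k _ [<- <-]]|r f r01 _ _|r f r01 _ _ aU].
- apply: on_range => //.
  (* The atom is a column of [A_rf], so [XsA] and [subX] place it in the range of [Xhat], and the
     SVD then places it in that of [U]. *)
  have : colspace Xs (avec M (rs k) (fs k)).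
    rewrite XsA; exists (delta_mx k ord0) => //.
    by rewrite -colE; apply/colP => m; rewrite !mxE.
  move=> /subX [v _ <-].
  exists (diag_mx (map_mx (real_complex R) s) *m V ^t* *m v) => //.
  by rewrite XhatE !mulmxA.
- exact: on_range.
rewrite l2normE /dual_poly QE rdot_dual_decomposition //.
(* [b] is the component of [a] orthogonal to the range of [U], nonzero because [a] lies outside that
   range. *)
set a := avec M r f; set b := a - U *m (U ^t* *m a).
have b0 : b != 0.
  apply: contra_not_neq aU => /eqP; rewrite subr_eq0 => /eqP aE.
  by exists (U ^t* *m a).
have -> : W ^t* *m a = W ^t* *m b.
  by rewrite mulmxBr mulmxA WU mul0mx subr0.
have := nonexpansive_lt_trmxC W1 b0.
have : rdot (U ^t* *m a) (U ^t* *m a) + rdot b b = 1.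
  rewrite -(rdot_avec f M_gt0 r01) -/a /b.
  rewrite !(rdotDl, rdotDr, rdotNl, rdotNr) (rdotC a (U *m _)) rdot_isometry //.
  by rewrite (rdot_mulmxl U); ring.
by move=> ab1 Wb; rewrite -[ltRHS]sqrtr1 ltr_sqrt //; lra.
Qed.
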